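(* Let $n\ge 3$ and let $G=D_{2n}$ be the dihedral group of order $2n$. If $S$ is a locally maximal product-free set of size $3$ in $G$, then $G=D_6$ or $G=D_8$. Furthermore, up to automorphisms of $G$, there is exactly one such set in each case: it is $\{y,xy,x^2y\}$ if $G=D_6$, and $\{x^2,y,xy\}$ if $G=D_8$. (That is, in each of these two groups the listed set is a locally maximal product-free set, and every locally maximal product-free set of size $3$ is the image of the listed set under an automorphism of $G$.)
   Context: For $n>1$, $D_{2n}=\langle x,y \mid x^n=y^2=1,\ xy=yx^{-1}\rangle$ is the dihedral group of order $2n$. For subsets $S,V$ of a group $G$, $SV=\{sv : s\in S, v\in V\}$. A non-empty subset $S$ of a finite group $G$ is product-free if $S\cap SS=\varnothing$. A product-free set $S$ is locally maximal if whenever $T$ is a product-free subset of $G$ with $S\subseteq T$, then $S=T$. *)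

(* Defs.v *)
From mathcomp Require Import all_boot all_fingroup all_solvable.

Set Implicit Arguments.
Unset Strict Implicit.
Unset Printing Implicit Defensive.

Local Open Scope group_scope.

(* When [G \isog 'D_(n.*2)], so that #|G| = 2n, this says that (x, y)         *)
(* exhibits G as < x, y | x^n = y^2 = 1, x y = y x^-1 >.                      *)
Definition dihedral_generators (gT : finGroupType) (G : {set gT}) (n : nat)
    (x y : gT) : Prop :=
  [/\ <<[set x; y]>> = G, x ^+ n = 1, y ^+ 2 = 1 & x * y = y * x^-1].

Definition product_free (gT : finGroupType) (G S : {set gT}) : Prop :=
  [/\ S \subset G, S != set0 & S :&: S * S = set0].

Definition locally_maximal_product_free (gT : finGroupType) (G S : {set gT}) :
    Prop :=
  product_free G S /\
  forall T : {set gT}, product_free G T -> S \subset T -> S = T.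

(* Main.v *)
Require Import Defs.
From mathcomp Require Import all_boot all_fingroup all_solvable.

Local Open Scope group_scope.

(* Let [X = <x>], [A = S :&: X] and [B = S :\: X]. If a reflection [t] is not *)
(* in [S], then [t |: S] is not product-free; a solution of [u * v = w] in [t *)
(* |: S] involves [t] exactly once, since [t] is an involution and [1] is not *)
(* in [S], and parity modulo [X] makes [t] a product, in some order, of an    *)
(* element of [A] and one of [B]. Hence [n <= #|B| * (2 * #|A| + 1)], which   *)
(* is at most 6 when [#|A| + #|B| = 3]. The groups with [n <= 6] are searched *)
(* exhaustively; for [n = 3, 4] the sets found are all conjugate.             *)

(** Local maximality is a covering condition: every reflection outside [S] is a product of an
    element of [A] and one of [B], in one of the two orders. Counting the [n] reflections gives
    [locally_maximal_product_free_bound], and [locally_maximal_card3_bound] leaves only [n] from 3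
    to 6. Coding x^i y^b by the pair (i, b) turns the rest into boolean computation:
    [locally_maximal_codeP] shows that the coded test is faithful, and [locally_maximal_card3_codes]
    that [lmpf3_codes] misses no set of size 3. Nothing is found for [n] = 5, 6; for [n] = 3, 4
    every set found is conjugate to the listed one, and conjugation is an automorphism
    ([locally_maximal_card3_unique]). *)

Definition dihedral_elt {gT : finGroupType} (x y : gT) (c : nat * bool) : gT :=
  x ^+ c.1 * y ^+ c.2.

Definition dihedral_codes (n : nat) : seq (nat * bool) :=
  [seq (i, b) | i <- iota 0 n, b <- [:: false; true]].

(* Since [n - b.1] is truncated, this is only meaningful for [b.1 <= n]. *)
Definition mul_code (n : nat) (a b : nat * bool) : nat * bool :=
  ((if a.2 then a.1 + (n - b.1) else a.1 + b.1) %% n, a.2 (+) b.2)%N.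

(** Non-emptiness is not tested, so the transfer lemmas assume [s != [::]]. *)
Definition code_product_free (n : nat) (s : seq (nat * bool)) : bool :=
  all (fun a => all (fun b => mul_code n a b \notin s) s) s.

(** One-element extensions suffice, since a non-empty subset of a product-free set is
    product-free. *)
Definition code_locally_maximal (n : nat) (s : seq (nat * bool)) : bool :=
  code_product_free n s
  && all (fun c => (c \in s) || ~~ code_product_free n (c :: s))
         (dihedral_codes n).

(* For sets of equal size: some [c] conjugates [t] onto [s]; [b = a ^ c] is *)
(* tested as [c * b = a * c] to avoid inverses.                             *)
Definition code_conjugate (n : nat) (s t : seq (nat * bool)) : bool :=
  has (fun c => all (fun a => has (fun b => mul_code n c b == mul_code n a c) s)
                    t)
      (dihedral_codes n).

(** Keeping the order of [s] represents each [k]-element subset of a duplicate-free list exactly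
    once. *)
Fixpoint subseqs {T : Type} (k : nat) (s : seq T) : seq (seq T) :=
  match k, s with
  | 0, _ => [:: [::]]
  | _, [::] => [::]
  | k'.+1, a :: s' => map (cons a) (subseqs k' s') ++ subseqs k s'
  end.

Definition lmpf3_codes (n : nat) : seq (seq (nat * bool)) :=
  [seq s <- subseqs 3 (dihedral_codes n) | code_locally_maximal n s].

Definition dihedral_set {gT : finGroupType} (x y : gT)
    (s : seq (nat * bool)) : {set gT} :=
  [set g in map (dihedral_elt x y) s].

Lemma mem_subseqs (T : eqType) (k : nat) (s t : seq T) :
  (t \in subseqs k s) = (size t == k) && subseq t s.
Proof.
elim: s k t => [|a s IHs] [|k] [|b t] //=; first by rewrite andbF.
  by rewrite mem_cat IHs orbF; apply/mapP=> -[].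
rewrite mem_cat IHs.
have [->|b'a] := eqVneq b a; last first.
  rewrite orb_idl // => /mapP[u _ [eq_ba _]].
  by rewrite eq_ba eqxx in b'a.
rewrite mem_map; last by move=> u v [].
rewrite IHs orb_idr // => /andP[/eqP[<-] sub_at]; rewrite eqxx.
exact: subseq_trans (subseq_cons t a) sub_at.
Qed.

Lemma mem_dihedral_codes (n : nat) (c : nat * bool) :
  (c \in dihedral_codes n) = (c.1 < n)%N.
Proof.
apply/allpairsP/idP => [[[i b] /= [+ _ ->]]|]; first by rewrite mem_iota.
by case: c => i b lt_in; exists (i, b); split=> /=;
  [rewrite mem_iota | case: b {lt_in} |].
Qed.

Lemma size_dihedral_codes (n : nat) : size (dihedral_codes n) = n.*2.
Proof. by rewrite size_allpairs size_iota muln2. Qed.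

Lemma lmpf3_codes5 : lmpf3_codes 5 = [::].
Proof. by vm_compute. Qed.

Lemma lmpf3_codes6 : lmpf3_codes 6 = [::].
Proof. by vm_compute. Qed.

Lemma mem_mul_code (n : nat) (a b : nat * bool) :
  (0 < n)%N -> mul_code n a b \in dihedral_codes n.
Proof. by move=> n_gt0; rewrite mem_dihedral_codes ltn_mod. Qed.

(** * Faithfulness of the codes *)

Section Dihedral.

Variables (gT : finGroupType) (G : {group gT}) (n : nat) (x y : gT).
Hypotheses (n_gt0 : (0 < n)%N) (oG : #|G| = n.*2).
Hypothesis genG : dihedral_generators G n x y.

Let X := <[x]>.
Let elt := dihedral_elt x y.
Let codes := dihedral_codes n.

(** The relation moves [y] past a power: y x^k = x^(n-k) y for k <= n. Only [b] is moved past, so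
    only [b] has to be a code. *)
Lemma dihedral_eltM (a b : nat * bool) :
  b \in codes -> elt a * elt b = elt (mul_code n a b).
Proof.
case: genG => _ xn y2 xy; rewrite mem_dihedral_codes => /ltnW le_bn.
have yX k : y * x ^- k = x ^+ k * y.
  elim: k => [|k IHk]; first by rewrite invg1 mulg1 mul1g.
  by rewrite expgSr invMg mulgA -xy -mulgA IHk mulgA -expgS -expgSr.
have yV k : (k <= n)%N -> y * x ^+ k = x ^+ (n - k) * y.
  move=> le_kn; rewrite -yX; congr (_ * _).
  by apply: (mulIg (x ^+ (n - k))); rewrite -expgD subnKC // mulVg.
have y22 : y * y = 1 by [].
case: a b le_bn => [i []] [j []] /= le_jn;
  rewrite /elt /dihedral_elt /mul_code /= ?expg0 ?expg1 ?mulg1.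
all: rewrite expg_mod // expgD //.
- by rewrite -mulgA (mulgA y) yV // -!mulgA y22 !mulg1.
- by rewrite -mulgA yV // mulgA.
- by rewrite mulgA.
Qed.

(** An element of the generated group is a word in [x] and [y]; induction on its length multiplies
    codes. *)
Lemma dihedral_elt_surj (g : gT) :
  g \in G -> exists2 c, c \in codes & g = elt c.
Proof.
case: genG => <- xn y2 _ /gen_prodgP[m [c cP ->]] {g}.
elim: m c cP => [|m IHm] c cP.
  rewrite big_ord0; exists (0, false); first by rewrite mem_dihedral_codes.
  by rewrite /elt /dihedral_elt mulg1.
rewrite big_ord_recr /=.
have [i|a _ ->] := IHm (fun i => c (widen_ord (leqnSn m) i)); first exact: cP.
have [b Cb ->] : exists2 b, b \in codes & c ord_max = elt b.
  have:= cP ord_max; rewrite !inE => /orP[] /eqP->.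
    (* Reduced modulo [n] because [n] = 1 is allowed in this section. *)
    exists (1 %% n, false)%N; first by rewrite mem_dihedral_codes ltn_mod.
    by rewrite /elt /dihedral_elt expg_mod // mulg1.
  exists (0, true)%N; first by rewrite mem_dihedral_codes.
  by rewrite /elt /dihedral_elt mul1g.
by rewrite dihedral_eltM //; exists (mul_code n a b); rewrite ?mem_mul_code.
Qed.

Lemma mem_dihedral_elt (c : nat * bool) : elt c \in G.
Proof.
case: genG => <- _ _ _.
by rewrite groupM // groupX // mem_gen // !inE eqxx ?orbT.
Qed.

(** The 2n codes cover a group of order 2n, so no two of them can collide. *)
Lemma dihedral_elt_inj : {in codes &, injective elt}.
Proof.
have u : uniq (map elt codes).
  apply: (@leq_size_uniq _ (enum G)); first exact: enum_uniq.
    move=> g; rewrite mem_enum => /dihedral_elt_surj[c Cc ->].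
    exact: map_f.
  by rewrite size_map size_dihedral_codes -cardE oG.
move=> a b Ca Cb eq_ab; rewrite -(nth_index a Ca) -(nth_index a Cb).
congr nth; apply/eqP; rewrite -(nth_uniq (elt a) _ _ u) ?size_map ?index_mem //.
by rewrite !(nth_map a) ?index_mem // !nth_index ?eq_ab.
Qed.

Lemma mem_dihedral_set (s : seq (nat * bool)) (c : nat * bool) :
    {subset s <= codes} -> c \in codes ->
  (elt c \in dihedral_set x y s) = (c \in s).
Proof.
move=> Cs Cc; rewrite inE; apply/mapP/idP => [[d ds]|cs]; last by exists c.
by move/dihedral_elt_inj=> -> //; apply: Cs.
Qed.

Lemma dihedral_setP (s : seq (nat * bool)) (g : gT) :
  reflect (exists2 c, c \in s & g = elt c) (g \in dihedral_set x y s).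
Proof. by rewrite inE; apply: mapP. Qed.

Lemma card_dihedral_set (s : seq (nat * bool)) :
  uniq s -> {subset s <= codes} -> #|dihedral_set x y s| = size s.
Proof.
move=> Us Cs; rewrite cardsE -(size_map elt); apply/card_uniqP.
rewrite map_inj_in_uniq // => a b /Cs Ca /Cs Cb; exact: dihedral_elt_inj.
Qed.

Lemma dihedral_set_filter (A : {set gT}) :
  A \subset G -> A = dihedral_set x y [seq c <- codes | elt c \in A].
Proof.
move=> sAG; apply/setP=> g; apply/idP/dihedral_setP => [Ag | [c + ->]].
  have [c Cc def_g] := dihedral_elt_surj g (subsetP sAG g Ag).
  by exists c; rewrite // mem_filter Cc -def_g Ag.
by rewrite mem_filter => /andP[].
Qed.

Lemma uniq_dihedral_codes : uniq codes.
Proof.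
by apply: allpairs_uniq; rewrite ?iota_uniq // => -[i b] [j c] _ _ [-> ->].
Qed.

Lemma product_free_codeP (s : seq (nat * bool)) :
    s != [::] -> {subset s <= codes} ->
  product_free G (dihedral_set x y s) <-> code_product_free n s.
Proof.
move=> s_neq0 Cs; split=> [[_ _ SS0]|/allP pf_s].
  apply/allP=> a sa; apply/allP=> b sb; apply/negP=> sab.
  have: elt (mul_code n a b)
      \in dihedral_set x y s :&: dihedral_set x y s * dihedral_set x y s.
    rewrite inE mem_dihedral_set //; last by exact: mem_mul_code.
    by rewrite sab -dihedral_eltM ?mem_mulg ?mem_dihedral_set //; exact: Cs.
  by rewrite SS0 inE.
split.
- by apply/subsetP=> _ /dihedral_setP[c _ ->]; apply: mem_dihedral_elt.
- apply/set0Pn; case: s s_neq0 {Cs pf_s} => // c s _; exists (elt c).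
  by apply/dihedral_setP; exists c; rewrite ?mem_head.
apply/setP=> g; rewrite !inE; apply/negP=> /andP[/mapP[c sc ->]].
case/mulsgP=> _ _ /dihedral_setP[a sa ->] /dihedral_setP[b sb ->].
rewrite dihedral_eltM; last exact: Cs.
move/dihedral_elt_inj=> def_c; have /allP/(_ b sb) := pf_s a sa.
by rewrite -def_c ?sc ?mem_mul_code //; apply: Cs.
Qed.

Lemma locally_maximal_codeP (s : seq (nat * bool)) :
    s != [::] -> {subset s <= codes} ->
  locally_maximal_product_free G (dihedral_set x y s)
    <-> code_locally_maximal n s.
Proof.
move=> s_neq0 Cs.
have Ccs c : c \in codes -> {subset c :: s <= codes}.
  by move=> Cc d; rewrite inE => /predU1P[->|/Cs].
have sub_cs c : dihedral_set x y s \subset dihedral_set x y (c :: s).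
  apply/subsetP=> _ /dihedral_setP[d sd ->].
  by apply/dihedral_setP; exists d; rewrite // inE sd orbT.
split=> [[/(product_free_codeP _ s_neq0 Cs) pf_s max_s]
        |/andP[pf_s /allP max_s]].
  rewrite /code_locally_maximal pf_s; apply/allP=> c Cc.
  have [pf_cs|] := boolP (code_product_free n (c :: s)); last by rewrite orbT.
  have /max_s/(_ (sub_cs c)) eqT : product_free G (dihedral_set x y (c :: s)).
    by apply/product_free_codeP=> //; apply: Ccs.
  rewrite orbF -mem_dihedral_set // eqT mem_dihedral_set ?mem_head //.
  exact: Ccs.
split=> [|T pfT sST]; first exact/product_free_codeP.
apply/eqP; rewrite eqEsubset sST; apply/subsetP=> g Tg.
have [sTG _ TT0] := pfT.
have [c Cc def_g] := dihedral_elt_surj g (subsetP sTG g Tg).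
(* Otherwise [c :: s] would fail to be product-free, yet its elements all lie in [T]. *)
rewrite def_g mem_dihedral_set //; have /orP[//|/negP[]] := max_s c Cc.
have Tcs d : d \in c :: s -> elt d \in T.
  rewrite inE => /predU1P[->|sd]; first by rewrite -def_g.
  by apply: (subsetP sST); rewrite mem_dihedral_set //; apply: Cs.
apply/allP=> a csa; apply/allP=> b csb; apply/negP=> /Tcs.
rewrite -dihedral_eltM => [Tab|]; last exact: (Ccs c).
have: elt a * elt b \in T :&: T * T by rewrite inE Tab mem_mulg ?Tcs.
by rewrite TT0 inE.
Qed.

(** * The bound on [n] *)

Lemma locally_maximal_product_free_bound (S : {set gT}) :
    locally_maximal_product_free G S ->
  (n <= #|S :\: X| * (#|S :&: X|.*2).+1)%N.
Proof.
case=> -[sSG S_neq0 SS0] maxS; set A := S :&: X; set B := S :\: X.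
(* If [y] were a power of [x], two distinct codes would name the same element. *)
have EX c : c \in codes -> (elt c \in X) = ~~ c.2.
  case: c => i [] _ /=; rewrite /elt /dihedral_elt /=; last first.
    by rewrite mulg1 mem_cycle.
  rewrite groupMl ?mem_cycle //; apply/negP=> /cycleP[j def_y].
  have /dihedral_elt_inj : elt (0, true) = elt (j %% n, false)%N.
    case: genG => _ xn _ _.
    by rewrite /elt /dihedral_elt /= mul1g mulg1 expg_mod.
  by rewrite !mem_dihedral_codes ltn_mod n_gt0 => /(_ isT isT).
have oGX : #|G :\: X| = n.
  have -> : G :\: X = dihedral_set x y [seq (i, true) | i <- iota 0 n].
    apply/setP=> g; rewrite inE; apply/andP/dihedral_setP => [[X'g]|].
      move=> /dihedral_elt_surj[[i b] Cib def_g]; exists (i, b) => //.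
      move: X'g; rewrite def_g EX // negbK /= => ->.
      by rewrite map_f // mem_iota; rewrite mem_dihedral_codes in Cib.
    case=> _ /mapP[i + ->] ->; rewrite mem_iota mem_dihedral_elt => lt_in.
    by rewrite EX // mem_dihedral_codes.
  rewrite card_dihedral_set ?size_map ?size_iota //.
    by rewrite map_inj_uniq ?iota_uniq // => i j [].
  by move=> _ /mapP[i + ->]; rewrite mem_iota mem_dihedral_codes.
(* Parity: [X] has index 2. *)
have XM g h : g \in G -> h \in G -> (g * h \in X) = ((g \in X) == (h \in X)).
  move=> /dihedral_elt_surj[a Ca ->] /dihedral_elt_surj[b Cb ->].
  by rewrite dihedral_eltM // !EX ?mem_mul_code //=; case: a.2; case: b.2.
have rr1 r : r \in G :\: X -> r * r = 1.
  rewrite inE => /andP[X'r /dihedral_elt_surj[[i b] Cib def_r]]; move: X'r.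
  rewrite def_r EX // negbK dihedral_eltM //= => b1.
  rewrite /mul_code b1 /= subnKC ?modnn ?addbb; first exact: mulg1.
  by rewrite mem_dihedral_codes in Cib; apply: ltnW.
(* Both [r] and [r * g] are reflections, hence involutions; expand (r g)(r g) = 1. *)
have rX r g : r \in G :\: X -> g \in X -> r * g = g^-1 * r.
  move=> GXr Xg; have [Gr X'r] := setDP GXr.
  have Gg : g \in G.
    case/cycleP: Xg => i ->; rewrite -(mulg1 (x ^+ i)).
    exact: (mem_dihedral_elt (i, false)).
  have /rr1 rg1 : r * g \in G :\: X by rewrite inE XM // Xg (negPf X'r) groupM.
  by apply: (mulgI g); rewrite mulKVg; apply: (mulgI r); rewrite mulgA rg1 rr1.
have pfS u v : u \in S -> v \in S -> u * v \notin S.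
  move=> Su Sv; apply/negP=> Suv.
  have: u * v \in S :&: S * S by rewrite inE Suv mem_mulg.
  by rewrite SS0 inE.
have S1 : 1 \notin S.
  by apply/negP=> S1; have := pfS 1 1 S1 S1; rewrite mulg1 S1.
have sGX : G :\: X \subset B :|: (A * B :|: B * A).
  apply/subsetP=> t GXt; have [Gt X't] := setDP GXt; rewrite !inE X't /=.
  have [//|/= S't] := boolP (t \in S).
  have [u tSu [v tSv tSuv]] : exists2 u, u \in t |: S
      & exists2 v, v \in t |: S & u * v \in t |: S.
    have [/exists_inP[u Tu /exists_inP[v Tv Tuv]]|no_uv] :=
      boolP [exists u in t |: S, exists v in t |: S, u * v \in t |: S].
      by exists u => //; exists v.
    case/negP: S't; rewrite (maxS (t |: S)) ?setU11 ?subsetUr //.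
    split; first by rewrite subUset sub1set Gt.
      by apply/set0Pn; exists t; apply: setU11.
    apply/setP=> w; rewrite !inE; apply/negP=> /andP[Tw].
    case/mulsgP=> u v Tu Tv def_w.
    case/exists_inP: no_uv; exists u => //; apply/exists_inP; exists v => //.
    by rewrite -def_w !inE.
  have t_neq1 : t != 1 by apply: contraNneq X't => ->; rewrite group1.
  have tt1 := rr1 t GXt.
  have GS g : g \in S -> g \in G := subsetP sSG g.
  have memA g : g \in S -> g \in X -> g \in A by rewrite inE => -> ->.
  have memB g : g \in S -> g \notin X -> g \in B by rewrite inE => -> ->.
  case/setU1P: tSu tSuv => [->|Su]; case/setU1P: tSv => [->|Sv].
  - by rewrite tt1 in_setU1 eq_sym (negPf t_neq1) (negPf S1).
  - case/setU1P=> [/(canRL (mulKg t))|Stv].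
      by rewrite mulVg => v1; rewrite v1 (negPf S1) in Sv.
    have := XM t v Gt (GS v Sv); rewrite (negPf X't).
    case: (boolP (v \in X)) => Xv /= Xtv.
      (* Here t v = v^-1 t, so t = v (t v). *)
      apply/orP; left; apply/mulsgP; exists v (t * v);
        rewrite ?memA ?memB ?Xtv //.
      by rewrite (rX t v) // mulKVg.
    apply/orP; left; apply/mulsgP; exists (t * v) v;
      rewrite ?memA ?memB ?Xtv //.
    by rewrite -mulgA rr1 ?mulg1 // inE Xv GS.
  - case/setU1P=> [/(canRL (mulgK t))|Sut].
      by rewrite mulgV => u1; rewrite u1 (negPf S1) in Su.
    have := XM u t (GS u Su) Gt; rewrite (negPf X't).
    case: (boolP (u \in X)) => Xu /= Xut.
      (* Here t u = u^-1 t, so t = (u t) u. *)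
      apply/orP; right; apply/mulsgP; exists (u * t) u;
        rewrite ?memA ?memB ?Xut //.
      by rewrite -mulgA (rX t u) // mulKVg.
    apply/orP; right; apply/mulsgP; exists u (u * t);
      rewrite ?memA ?memB ?Xut //.
    by rewrite mulgA rr1 ?mul1g // inE Xu GS.
  case/setU1P=> [def_t|]; last by rewrite (negPf (pfS u v Su Sv)).
  have := XM u v (GS u Su) (GS v Sv); rewrite def_t (negPf X't).
  case: (boolP (u \in X)) => Xu; case: (boolP (v \in X)) => Xv // _.
    by apply/orP; left; rewrite -def_t mem_mulg ?memA ?memB.
  by apply/orP; right; rewrite -def_t mem_mulg ?memA ?memB.
(* Union bound: n <= |B| + |A||B| + |B||A|. *)
rewrite -[leqLHS]oGX (leq_trans (subset_leq_card sGX)) //.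
rewrite (leq_trans (leq_card_setU _ _)) // mulnS leq_add2l.
rewrite (leq_trans (leq_card_setU _ _)) // -addnn mulnDr.
have leM (C D : {set gT}) : (#|(C * D)%g| <= #|C| * #|D|)%N.
  rewrite -cardsX -[(C * D)%g]/(mulg @2: (C, D)) curry_imset2X.
  exact: leq_imset_card.
by rewrite leq_add ?leM // mulnC leM.
Qed.

Lemma locally_maximal_card3_bound (S : {set gT}) :
  locally_maximal_product_free G S -> #|S| = 3%N -> (n <= 6)%N.
Proof.
move=> /locally_maximal_product_free_bound; rewrite -(cardsID X S).
move: #|S :&: X| #|S :\: X| => a b le_n ab3; apply: leq_trans le_n _.
(* For |A| = 0, 1, 2, 3 the bound is 3, 6, 5, 0. *)
by case: a b ab3 => [|[|[|[|a]]]] [|[|[|[|b]]]].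
Qed.

(** * Completeness of the search, and conjugacy *)

Lemma locally_maximal_card3_codes (S : {set gT}) :
    locally_maximal_product_free G S -> #|S| = 3%N ->
  exists2 s, s \in lmpf3_codes n & S = dihedral_set x y s.
Proof.
move=> maxS S3; have [[sSG _ _] _] := maxS.
set s := [seq c <- codes | elt c \in S].
have def_S : S = dihedral_set x y s := dihedral_set_filter S sSG.
have Cs : {subset s <= codes} by move=> c; rewrite mem_filter => /andP[].
have Us : uniq s := filter_uniq _ uniq_dihedral_codes.
exists s => //; rewrite def_S card_dihedral_set // in S3.
have s_neq0 : s != [::] by rewrite -size_eq0 S3.
have lm_s : code_locally_maximal n s.
  by apply/locally_maximal_codeP=> //; rewrite -def_S.
by rewrite mem_filter lm_s mem_subseqs S3 filter_subseq.
Qed.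

(** The test only puts a conjugate of one set inside the other; equal cardinality makes the
    inclusion an equality. *)
Lemma code_conjugate_Aut (s t : seq (nat * bool)) :
    {subset s <= codes} -> {subset t <= codes} -> code_conjugate n s t ->
    #|dihedral_set x y s| = #|dihedral_set x y t| ->
  exists2 f : {perm gT},
    f \in Aut G & dihedral_set x y s = f @: dihedral_set x y t.
Proof.
move=> Cs Ct /hasP[c Cc /allP st] eq_card; have Gc := mem_dihedral_elt c.
exists (conj_aut G (elt c)); first by rewrite Aut_aut.
apply/eqP; rewrite eq_sym eqEcard eq_card.
rewrite card_imset ?leqnn ?andbT; last exact: perm_inj.
apply/subsetP=> _ /imsetP[_ /dihedral_setP[a ta ->] ->].
have /hasP[b sb /eqP eq_ba] := st a ta.
apply/dihedral_setP; exists b => //.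
rewrite conj_autE ?mem_dihedral_elt //; apply/(mulgI (elt c)).
by rewrite -conjgC !dihedral_eltM ?eq_ba // Cs.
Qed.

(** Gathers all that must be checked about a candidate [t] into one boolean, which [vm_compute]
    decides for a concrete [n]. *)
Lemma locally_maximal_card3_unique (t : seq (nat * bool)) :
    [&& size t == 3, uniq t, all (mem codes) t, code_locally_maximal n t
      & all (code_conjugate n ^~ t) (lmpf3_codes n)] ->
  [/\ locally_maximal_product_free G (dihedral_set x y t),
      #|dihedral_set x y t| = 3%N
    & forall S : {set gT},
        locally_maximal_product_free G S -> #|S| = 3%N ->
        exists2 f : {perm gT}, f \in Aut G & S = f @: dihedral_set x y t].
Proof.
case/and5P=> /eqP t3 Ut /allP Ct lm_t /allP conj_t.
have card_t : #|dihedral_set x y t| = 3%N by rewrite card_dihedral_set.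
split=> // [|S maxS S3].
  by apply/locally_maximal_codeP=> //; rewrite -size_eq0 t3.
have [s lm_s def_S] := locally_maximal_card3_codes S maxS S3.
rewrite def_S; apply: code_conjugate_Aut (conj_t s lm_s) _ => //;
  last by rewrite card_t -def_S.
apply: mem_subseq; move: lm_s.
by rewrite mem_filter mem_subseqs => /and3P[].
Qed.

End Dihedral.

Theorem theorem3p4 (n : nat) (n_ge3 : (3 <= n)%N) (gT : finGroupType)
    (G : {group gT}) (x y : gT)
    (isoG : G \isog 'D_(n.*2)) (genG : dihedral_generators G n x y) :
  [/\ forall S : {set gT},
        locally_maximal_product_free G S -> #|S| = 3%N ->
        G \isog 'D_6 \/ G \isog 'D_8,
      G \isog 'D_6 ->
        [/\ locally_maximal_product_free G [set y; x * y; x ^+ 2 * y],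
            #|[set y; x * y; x ^+ 2 * y]| = 3%N
          & forall S : {set gT},
              locally_maximal_product_free G S -> #|S| = 3%N ->
              exists2 f : {perm gT},
                f \in Aut G & S = f @: [set y; x * y; x ^+ 2 * y]]
    & G \isog 'D_8 ->
        [/\ locally_maximal_product_free G [set x ^+ 2; y; x * y],
            #|[set x ^+ 2; y; x * y]| = 3%N
          & forall S : {set gT},
              locally_maximal_product_free G S -> #|S| = 3%N ->
              exists2 f : {perm gT},
                f \in Aut G & S = f @: [set x ^+ 2; y; x * y]]].
Proof.
have n_gt0 : (0 < n)%N by apply: leq_trans n_ge3.
have oG : #|G| = n.*2 by rewrite (card_isog isoG) card_dihedral // ltnW.
have oD q : G \isog 'D_(q.*2) -> (1 < q)%N -> n = q.
  by move=> /card_isog + q_gt1; rewrite oG card_dihedral // => /double_inj.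
split=> [S maxS S3 | /(oD 3%N)/(_ isT) n3 | /(oD 4%N)/(_ isT) n4].
- have le_n6 := locally_maximal_card3_bound gT G n x y n_gt0 oG genG S maxS S3.
  have [s lm_s _] :=
    locally_maximal_card3_codes gT G n x y n_gt0 oG genG S maxS S3.
  have : n \in iota 3 4 by rewrite mem_iota n_ge3.
  rewrite !inE => /or4P[] /eqP def_n; rewrite def_n in isoG lm_s.
  + by left.
  + by right.
  + by rewrite lmpf3_codes5 in lm_s.
  by rewrite lmpf3_codes6 in lm_s.
- have -> : [set y; x * y; x ^+ 2 * y]
      = dihedral_set x y [:: (0, true); (1, true); (2, true)]%N.
    by apply/setP=> g; rewrite !inE /dihedral_elt /= mul1g orbA.
  apply: locally_maximal_card3_unique n_gt0 oG genG _ _.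
  by rewrite n3; vm_compute.
have -> : [set x ^+ 2; y; x * y]
    = dihedral_set x y [:: (2, false); (0, true); (1, true)]%N.
  by apply/setP=> g; rewrite !inE /dihedral_elt /= mul1g mulg1 orbA.
apply: locally_maximal_card3_unique n_gt0 oG genG _ _.
by rewrite n4; vm_compute.
Qed.
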